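(* Let $(\lambda_k)_{k\ge1}$ be a real sequence with $\sum_{k=1}^\infty|\lambda_k|\le1/2$, and let $C$ be the copula $$C(u,v)=uv+\frac{2}{\pi^2}\sum_{k=1}^\infty\frac{\lambda_k}{k^2}\sin(k\pi u)\sin(k\pi v).$$ Then $$\tau(C)=\frac{64}{\pi^4}\sum_{k=0}^\infty\frac{\lambda_{2k+1}}{(2k+1)^4}+\frac{16}{\pi^4}\sum_{k=1}^\infty\sum_{j=k+1}^\infty\frac{2\lambda_k\lambda_j}{(k^2-j^2)^2}\bigl(1-\cos((j+k)\pi)\bigr)^2,$$ $$\rho_S(C)=\frac{96}{\pi^4}\sum_{k=0}^\infty\frac{\lambda_{2k+1}}{(2k+1)^4},$$ and $$-\frac{48}{\pi^4}\le\rho_S(C)\le\frac{48}{\pi^4},\qquad -\frac{32}{\pi^4}\le\tau(C)\le\frac{32}{\pi^4}.$$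
   Context: For a copula $C$ on $[0,1]^2$, Spearman's rho and Kendall's tau are defined by $$\rho_S(C)=12\int_0^1\int_0^1 C(u,v)\,du\,dv-3,\qquad \tau(C)=1-4\int_0^1\int_0^1 C_{,1}(u,v)C_{,2}(u,v)\,du\,dv,$$ where $C_{,i}$ is the partial derivative of $C$ with respect to its $i$-th variable. *)

(* Defs.v *)
From HB Require Import structures.
From mathcomp Require Export all_boot all_order all_algebra.
From mathcomp Require Export all_classical all_reals all_analysis.

Set Implicit Arguments.
Unset Strict Implicit.
Unset Printing Implicit Defensive.

Export Order.TTheory GRing.Theory Num.Theory.
Export numFieldNormedType.Exports.

Local Open Scope classical_set_scope.
Local Open Scope ring_scope.

(* The library declares this notation for extended reals only. As there, the
   sum is the limit of the partial sums over [m <= i < n]. *)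
Notation "\sum_ ( m <= i '<oo' ) F" :=
  (\big[+%R/0%R]_(m <= i <oo) F%R) : ring_scope.

(* A copula is represented by a function on the whole plane, of which only the
   restriction to the unit square matters. *)
Record is_copula (R : realType) (C : R -> R -> R) : Prop := IsCopula {
  copula0l : forall v : R, 0 <= v <= 1 -> C 0 v = 0;
  copula0r : forall u : R, 0 <= u <= 1 -> C u 0 = 0;
  copula1l : forall v : R, 0 <= v <= 1 -> C 1 v = v;
  copula1r : forall u : R, 0 <= u <= 1 -> C u 1 = u;
  copula_2increasing : forall u1 u2 v1 v2 : R,
    0 <= u1 -> u1 <= u2 -> u2 <= 1 -> 0 <= v1 -> v1 <= v2 -> v2 <= 1 ->
    0 <= C u2 v2 - C u2 v1 - C u1 v2 + C u1 v1
}.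

Definition partial1 (R : realType) (C : R -> R -> R) (u v : R) : R :=
  derive1 (fun x : R => C x v) u.

Definition partial2 (R : realType) (C : R -> R -> R) (u v : R) : R :=
  derive1 (fun y : R => C u y) v.

(* In the next two definitions the integrals are Lebesgue integrals. The
   partial derivatives of a copula exist almost everywhere in the square; their
   default values elsewhere, in particular on the boundary, do not affect the
   integral. *)
Definition spearman_rho (R : realType) (C : R -> R -> R) : R :=
  12 * (\int[@lebesgue_measure R]_(v in `[0, 1])
          (\int[@lebesgue_measure R]_(u in `[0, 1]) C u v)) - 3.

Definition kendall_tau (R : realType) (C : R -> R -> R) : R :=
  1 - 4 * (\int[@lebesgue_measure R]_(v in `[0, 1])
             (\int[@lebesgue_measure R]_(u in `[0, 1])
                (partial1 C u v * partial2 C u v))).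

(* Main.v *)
Require Import Defs.
From mathcomp Require Import measurable_realfun ring lra zify.

(* Writing psi_0 = id and psi_k = sin (k pi .), the copula is the single series
   C(u, v) = sum_(k >= 0) c_k psi_k(u) psi_k(v) with c_0 = 1. Increments of psi_k
   are at most k pi times those of its argument, so in the C-volume of a
   rectangle the terms k >= 1 amount to at most 2 sum |lam_k| <= 1 times the term
   k = 0, which is its area. All the series are dominated by sum |lam_k|, so they
   can be differentiated (the first-order Taylor remainder of sin is quadratic)
   and integrated termwise. For tau this gives
   1 - 4 sum_(k, j) T(k, j), where T is symmetric, T(0, 0) = 1/4 and T(k, k) = 0
   for k >= 1, that is, - 8 sum_(k < j) T(k, j): the row k = 0 is the single sum
   of the formula, the other rows are the double sum.
   As T(k, j) vanishes unless k + j is odd, sum_(k < j) |T(k, j)| is at most a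
   constant times (sum of y_k over even k) * (sum of y_k over odd k) with
   y_k = |lam_k| for k >= 1, which yields the bound on tau. *)

Set Implicit Arguments.
Unset Strict Implicit.
Unset Printing Implicit Defensive.

Local Open Scope classical_set_scope.
Local Open Scope ring_scope.

(** * Absolutely convergent series *)

Section DominatedSeries.
Context {R : realType}.
Implicit Types (f b : R^nat).

(** Brings a sum with a lower index [m] to the form [limn (series _)], to which the convergence
    lemmas apply. *)
Lemma sum_from_mkcond (m : nat) f :
  \sum_(m <= k <oo) f k = \sum_(0 <= k <oo) (if (m <= k)%N then f k else 0).
Proof.
congr (limn _); apply/funext => n.
rewrite [LHS](big_nat_widenl _ 0%N) //= big_mkcond //=.
Qed.

Lemma dominated_cvg_series f b :
  (forall k, `|f k| <= b k) -> cvgn (series b) -> cvgn (series f).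
Proof.
move=> fb cb; apply: normed_cvg; apply: series_le_cvg cb => // k.
  exact: normr_ge0.
exact: le_trans (normr_ge0 _) (fb k).
Qed.

(** For [m >= n] the block of [f] between [n] and [m] is bounded termwise by that of [b]; then [m]
    tends to infinity. *)
Lemma dominated_series_tail f b (n : nat) :
  (forall k, `|f k| <= b k) -> cvgn (series b) ->
  `|limn (series f) - series f n| <= limn (series b) - series b n.
Proof.
move=> fb cb; have cf := dominated_cvg_series fb cb.
have cl : (fun m => `|series f m - series f n|) @ \oo -->
    `|limn (series f) - series f n|.
  by apply: cvg_norm; apply: cvgB => //; exact: cvg_cst.
have cr : (fun m => series b m - series b n) @ \oo -->
    limn (series b) - series b n by apply: cvgB => //; exact: cvg_cst.
rewrite -(cvg_lim (@Rhausdorff R) cl) -(cvg_lim (@Rhausdorff R) cr).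
apply: ler_lim; [by apply/cvg_ex; eexists; exact: cl| |].
  by apply/cvg_ex; eexists; exact: cr.
near=> m.
have nm : (n <= m)%N by near: m; exists n.
rewrite !sub_series_geq // (le_trans (ler_norm_sum _ _ _)) //.
exact: ler_sum.
Unshelve. all: by end_near.
Qed.

Lemma dominated_series_le f b :
  (forall k, `|f k| <= b k) -> cvgn (series b) ->
  `|limn (series f)| <= limn (series b).
Proof.
move=> fb cb; have := dominated_series_tail 0 fb cb.
by rewrite !seriesEnat /= !big_geq // !subr0.
Qed.

Lemma cvg_seriesZ b (c : R) : cvgn (series b) -> cvgn (series (fun k => c * b k)).
Proof.
move=> cb; rewrite (_ : (fun k => c * b k) = c *: b) //.
exact: is_cvg_seriesZ.
Qed.

Lemma lim_mulr_series b (c : R) : cvgn (series b) ->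
  limn (series (fun k => c * b k)) = c * limn (series b).
Proof.
move=> cb; rewrite (_ : (fun k => c * b k) = c *: b) //.
exact: lim_seriesZ.
Qed.

(* The difference between the square and the strip [k < n] is bounded by
   [limn (series b)] times a tail of [b]. *)
Lemma cvg_square_sums (T : nat -> nat -> R) b :
  (forall k j, `|T k j| <= b k * b j) -> cvgn (series b) ->
  (fun n => \sum_(0 <= k < n) \sum_(0 <= j < n) T k j) @ \oo -->
  \sum_(0 <= k <oo) \sum_(0 <= j <oo) T k j.
Proof.
move=> Tb cb.
have b0 k : 0 <= b k * b k by rewrite (le_trans _ (Tb k k)).
pose B := limn (series b).
pose S k := limn (series (T k)).
have cTk k : cvgn (series (fun j => b k * b j)) by exact: cvg_seriesZ.
have limb k : limn (series (fun j => b k * b j)) = b k * B.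
  exact: lim_mulr_series.
have Sle k : `|S k| <= B * b k.
  by rewrite mulrC -limb; exact: dominated_series_le.
have cS : cvgn (series S).
  by apply: dominated_cvg_series Sle _; exact: cvg_seriesZ.
have tail n k : `|S k - \sum_(0 <= j < n) T k j| <= b k * (B - series b n).
  rewrite mulrBr -limb; have := dominated_series_tail n (Tb k) (cTk k).
  move=> /le_trans; apply; rewrite lerD2l lerN2 seriesEnat /=.
  by rewrite mulr_sumr seriesEnat.
(* The error tends to [B * (B - B) = 0]; the rewrites put the limit into this shape so that the
   limit rules apply factor by factor. *)
have key : (fun n => series S n - series b n * (B - series b n)) @ \oo --> limn (series S).
  rewrite -[X in _ --> X](subr0) -[X in _ - X](mulr0 B) -[X in B * X](subrr B).
  by apply: cvgB => //; apply: cvgM => //; apply: cvgB => //; exact: cvg_cst.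
have key2 : (fun n => series S n + series b n * (B - series b n)) @ \oo --> limn (series S).
  rewrite -[X in _ --> X](addr0) -[X in _ + X](mulr0 B) -[X in B * X](subrr B).
  by apply: cvgD => //; apply: cvgM => //; apply: cvgB => //; exact: cvg_cst.
apply: (squeeze_cvgr _ key key2); apply: nearW => n.
rewrite -ler_distl distrC seriesEnat /= -sumrB.
rewrite (le_trans (ler_norm_sum _ _ _)) // mulr_suml.
by apply: ler_sum => k _; have := tail n k; rewrite seriesEnat.
Qed.

Lemma sum_eq0 (m : nat) f : (forall k, (m <= k)%N -> f k = 0) ->
  \sum_(m <= k <oo) f k = 0.
Proof.
move=> f0; apply: cvg_lim => //.
rewrite (_ : (fun n => _) = fun=> 0); first exact: cvg_cst.
apply/funext => n.
by rewrite big_nat_cond big1 // => k /andP[/andP[mk _] _]; exact: f0.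
Qed.

Lemma eq_sum_from (m : nat) f g : (forall k, (m <= k)%N -> f k = g k) ->
  \sum_(m <= k <oo) f k = \sum_(m <= k <oo) g k.
Proof.
move=> fg; congr (limn _); apply/funext => n.
by apply: eq_big_nat => k /andP[mk _]; exact: fg.
Qed.

Lemma lim_sub_series f g : cvgn (series f) -> cvgn (series g) ->
  limn (series (fun k => f k - g k)) = limn (series f) - limn (series g).
Proof.
by move=> cf cg; rewrite (_ : (fun k => f k - g k) = f - g) //; exact: lim_seriesB.
Qed.

Lemma cvg_seriesB f g : cvgn (series f) -> cvgn (series g) ->
  cvgn (series (fun k => f k - g k)).
Proof.
by move=> cf cg; rewrite (_ : (fun k => f k - g k) = f - g) //; exact: is_cvg_seriesB.
Qed.

Lemma sum_recl f : cvgn (series f) ->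
  \sum_(0 <= k <oo) f k = f 0%N + \sum_(1 <= k <oo) f k.
Proof.
move=> cf; have c1 : (fun n => \sum_(1 <= k < n.+1) f k) @ \oo -->
    limn (series f) - f 0%N.
  rewrite (_ : (fun n => _) = (fun n => series f n.+1 - f 0%N)); last first.
    by apply/funext => n; rewrite seriesEnat /= [in RHS]big_ltn // addrC addKr.
  by apply: cvgB; [rewrite cvg_shiftS | exact: cvg_cst].
have c2 : (fun n => \sum_(1 <= k < n) f k) @ \oo --> limn (series f) - f 0%N.
  by rewrite -cvg_shiftS.
by rewrite (cvg_lim (@Rhausdorff R) c2) addrC subrK.
Qed.

Lemma sum1_mulr f (c : R) : cvgn (series f) ->
  \sum_(1 <= k <oo) (c * f k) = c * \sum_(1 <= k <oo) f k.
Proof.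
(* Adding the term of index 0 to both sides completes them to full series. *)
move=> cf; apply: (@addrI _ (c * f 0%N)).
rewrite -mulrDr -(sum_recl cf) -(sum_recl (cvg_seriesZ cf)).
exact: lim_mulr_series.
Qed.

Lemma nneg_series_cvg b (M : R) : (forall k, 0 <= b k) ->
  (forall n, series b n <= M) -> cvgn (series b) /\ limn (series b) <= M.
Proof.
move=> b0 bM; have cb : cvgn (series b).
  apply: nondecreasing_is_cvgn.
    by apply: nondecreasing_series => k _ _.
  by exists M => _ [n _ <-].
by split=> //; apply: limr_le => //; exact: nearW.
Qed.

End DominatedSeries.

(** * Integration on the unit interval *)

Section UnitIntegral.
Context {R : realType}.
Implicit Types f g : R -> R.
Notation mu := (@lebesgue_measure R).

(** Unlike integrability, this property is stable under products; it implies integrability because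
    the interval has finite measure. *)
Definition bounded_measurable01 f :=
  measurable_fun `[0 : R, 1] f /\ exists M, forall x : R, 0 <= x <= 1 -> `|f x| <= M.

Let m01 : measurable (`[0 : R, 1]%classic). Proof. exact: measurable_itv. Qed.

Let mu01 : mu `[0 : R, 1]%classic = 1%E.
Proof. by rewrite lebesgue_measure_itv /= lte_fin ltr01 oppr0 adde0. Qed.

Lemma bounded_measurable01_integrable f :
  bounded_measurable01 f -> mu.-integrable `[0, 1] (EFin \o f).
Proof.
move=> [mf [M fM]]; apply: measurable_bounded_integrable => //.
  by have := ltry (1 : R); rewrite -mu01.
exists M; split; first exact: num_real.
by move=> y My x /=; rewrite in_itv /= => /fM/le_trans; apply; exact: ltW.
Qed.

Lemma eq_bounded_measurable01 f g : (forall x : R, 0 <= x <= 1 -> f x = g x) ->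
  bounded_measurable01 g -> bounded_measurable01 f.
Proof.
move=> fg [mg [M gM]]; split; last by exists M => x x01; rewrite fg ?gM.
by apply: eq_measurable_fun mg => x; rewrite inE /= in_itv /= => x01; rewrite fg.
Qed.

Lemma bounded_measurable01D f g :
  bounded_measurable01 f -> bounded_measurable01 g ->
  bounded_measurable01 (fun x => f x + g x).
Proof.
move=> [mf [M fM]] [mg [N gN]]; split; first exact: measurable_funD.
by exists (M + N) => x x01; rewrite (le_trans (ler_normD _ _)) // lerD ?fM ?gN.
Qed.

Lemma bounded_measurable01B f g :
  bounded_measurable01 f -> bounded_measurable01 g ->
  bounded_measurable01 (fun x => f x - g x).
Proof.
move=> [mf [M fM]] [mg [N gN]]; split; first exact: measurable_funB.
by exists (M + N) => x x01; rewrite (le_trans (ler_normB _ _)) // lerD ?fM ?gN.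
Qed.

Lemma bounded_measurable01M f g :
  bounded_measurable01 f -> bounded_measurable01 g ->
  bounded_measurable01 (fun x => f x * g x).
Proof.
move=> [mf [M fM]] [mg [N gN]]; split; first exact: measurable_funM.
by exists (M * N) => x x01; rewrite normrM ler_pM ?fM ?gN.
Qed.

Lemma continuous_bounded_measurable01 f :
  continuous f -> bounded_measurable01 f.
Proof.
move=> cf; split.
  by apply: measurable_funTS; exact: continuous_measurable_fun.
have /compact_bounded[M [_ bM]] : compact (f @` `[0, 1]%classic).
  apply: continuous_compact; last exact: segment_compact.
  exact: continuous_subspaceT.
exists (M + 1) => x x01; apply: (bM (M + 1)); first by rewrite ltrDl.
by exists x.
Qed.

Lemma bounded_measurable01_cst (c : R) : bounded_measurable01 (fun=> c).
Proof. by apply: continuous_bounded_measurable01 => x; exact: cvg_cst. Qed.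

Lemma bounded_measurable01_id : bounded_measurable01 id.
Proof. by apply: continuous_bounded_measurable01 => x; exact: cvg_id. Qed.

Lemma bounded_measurable01_sum (g : nat -> R -> R) (n : nat) :
  (forall k, bounded_measurable01 (g k)) ->
  bounded_measurable01 (fun x => \sum_(0 <= k < n) g k x).
Proof.
move=> bg; elim: n => [|n IH].
  under eq_fun do rewrite big_geq //; exact: bounded_measurable01_cst.
under eq_fun do rewrite big_nat_recr //=; exact: bounded_measurable01D.
Qed.

Lemma Rintegral_cst01 (c : R) : \int[mu]_(x in `[0, 1]) c = c.
Proof. by rewrite Rintegral_cst // [X in fine X]mu01 mulr1. Qed.

Lemma Rintegral_sum01 (g : nat -> R -> R) (n : nat) :
  (forall k, bounded_measurable01 (g k)) ->
  \int[mu]_(x in `[0, 1]) (\sum_(0 <= k < n) g k x) =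
  \sum_(0 <= k < n) \int[mu]_(x in `[0, 1]) g k x.
Proof.
move=> bg; elim: n => [|n IH].
  rewrite big_geq //; under eq_Rintegral do rewrite big_geq //.
  by rewrite Rintegral_cst01.
under [LHS]eq_Rintegral do rewrite big_nat_recr //=.
rewrite RintegralD //; first by rewrite IH big_nat_recr.
all: apply: bounded_measurable01_integrable => //.
exact: bounded_measurable01_sum.
Qed.

(* The endpoints carry the default values of the partial derivatives. *)
Lemma Rintegral_eq_oo f g : bounded_measurable01 g ->
  (forall x : R, 0 < x < 1 -> f x = g x) ->
  \int[mu]_(x in `[0, 1]) f x = \int[mu]_(x in `[0, 1]) g x.
Proof.
move=> bg fg; have ig := bounded_measurable01_integrable bg.
have sub a b : [set` Interval (BSide a (0 : R)) (BSide b 1)] `<=` `[0 : R, 1].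
  by move=> x /=; rewrite !in_itv /=; case: a b => [] [] /= /andP[? ?];
    apply/andP; split; lra.
have igs a b : mu.-integrable [set` Interval (BSide a (0 : R)) (BSide b 1)] (EFin \o g).
  by apply: integrableS ig => //; exact: sub.
have oo : mu.-integrable `]0 : R, 1[ (EFin \o f).
  apply: eq_integrable (igs false true) => //.
  by move=> x; rewrite inE /= in_itv /= => x01; rewrite fg.
(* Adding two points to the open interval preserves measurability, whatever the values of [f]
   there. *)
have oc : measurable_fun `[0 : R, 1] f.
  apply: (@measurable_fun_itv_cc _ 0 1 false true); apply/measurable_EFinP.
  exact: (measurable_int mu oo).
have E h : measurable_fun `[0 : R, 1] h ->
   \int[mu]_(x in `[0 : R, 1]) h x = \int[mu]_(x in `]0 : R, 1[) h x.
  move=> mh; rewrite /Rintegral integral_itv_bndoo //.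
  by apply/measurable_EFinP; exact: measurable_funS mh.
rewrite !E //; last by case: bg.
by apply: eq_Rintegral => x; rewrite inE /= in_itv /= => x01; rewrite fg.
Qed.

(** The partial sums approximate the sum uniformly, up to a tail of [b]. As the interval has measure
    1, their integrals differ from that of the sum by no more than this tail. *)
Lemma Rintegral_series01 (g : nat -> R -> R) (b : nat -> R) :
  (forall k, bounded_measurable01 (g k)) ->
  (forall k (x : R), 0 <= x <= 1 -> `|g k x| <= b k) -> cvgn (series b) ->
  bounded_measurable01 (fun x => \sum_(0 <= k <oo) g k x) /\
  \int[mu]_(x in `[0, 1]) (\sum_(0 <= k <oo) g k x) =
  \sum_(0 <= k <oo) \int[mu]_(x in `[0, 1]) g k x.
Proof.
move=> bg gb cb.
have cg (x : R) : 0 <= x <= 1 -> series (g ^~ x) @ \oo --> \sum_(0 <= k <oo) g k x.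
  by move=> x01; apply: (@dominated_cvg_series _ _ b) => // k; exact: gb.
have bF : bounded_measurable01 (fun x => \sum_(0 <= k <oo) g k x).
  split.
    apply: (@measurable_fun_cvg _ _ _ _ (fun n x => series (g ^~ x) n)).
      by move=> n; rewrite /series /=; have [] := bounded_measurable01_sum n bg.
    by move=> x /=; rewrite in_itv /= => x01; exact: cg.
  exists (limn (series b)) => x x01.
  by apply: dominated_series_le => // k; exact: gb.
split=> //; apply/esym/cvg_lim => //.
pose F (x : R) : R := \sum_(0 <= k <oo) g k x.
have key n : `|\int[mu]_(x in `[0, 1]) F x -
    \sum_(0 <= k < n) \int[mu]_(x in `[0, 1]) g k x| <= limn (series b) - series b n.
  have bS := bounded_measurable01_sum n bg.
  have iS := bounded_measurable01_integrable bS.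
  have iF := bounded_measurable01_integrable bF.
  have iFS : mu.-integrable `[0, 1] (EFin \o (fun x => F x - \sum_(0 <= k < n) g k x)).
    exact/bounded_measurable01_integrable/bounded_measurable01B.
  rewrite -Rintegral_sum01 // -RintegralB //.
  apply: le_trans (le_normr_Rintegral _ iFS) _ => //.
  rewrite -[leRHS]Rintegral_cst01; apply: le_Rintegral => //.
  - exact: integrable_norm.
  - exact/bounded_measurable01_integrable/bounded_measurable01_cst.
  - move=> x /=; rewrite in_itv /= => x01.
    have := @dominated_series_tail _ (g ^~ x) b n (fun k => gb k x x01) cb.
    by rewrite /series /=.
have t0 : (fun n => limn (series b) - series b n) @ \oo --> 0.
  rewrite -[X in _ --> X](subrr (limn (series b))).
  by apply: cvgB => //; exact: cvg_cst.
apply/cvgrPdist_le => e e0; near=> n.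
apply: le_trans (key n) _; apply: le_trans (ler_norm _) _.
by near: n; move/cvgr0_norm_le : t0; exact.
Unshelve. all: by end_near.
Qed.

Lemma Rintegral01_FTC f (F : R -> R) :
  continuous f -> (forall x : R, is_derive x 1 F (f x)) ->
  \int[mu]_(x in `[0, 1]) f x = F 1 - F 0.
Proof.
move=> cf dF; rewrite /Rintegral (@continuous_FTC2 _ _ F) //.
- exact: continuous_subspaceT.
- have cF x : {for x, continuous F}.
    by apply/differentiable_continuous/derivable1_diffP; exact: (@ex_derive _ _ _ _ _ _ _ (dF x)).
  split; first by move=> x _; exact: (@ex_derive _ _ _ _ _ _ _ (dF x)).
  + exact/cvg_at_right_filter/cF.
  + exact/cvg_at_left_filter/cF.
- by move=> x _; rewrite derive1E; exact: derive_val.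
Qed.

End UnitIntegral.

(** * Termwise differentiation, and termwise integration of products of series *)

Section TermwiseCalculus.
Context {R : realType}.
Notation mu := (@lebesgue_measure R).

(** Summing the hypotheses on the remainders gives a quadratic remainder for [F], so the difference
    quotient with step [h] is within [|h| * limn (series b)] of the sum of [g']. *)
Lemma derive1_series (F : R -> R) (g : nat -> R -> R) (g' b : nat -> R) (u : R) :
  0 < u < 1 ->
  (forall x, 0 < x < 1 -> F x = \sum_(0 <= k <oo) g k x) ->
  (forall x, 0 < x < 1 -> cvgn (series (g ^~ x))) ->
  cvgn (series g') -> cvgn (series b) ->
  (forall k x, `|g k x - g k u - (x - u) * g' k| <= (x - u) ^+ 2 * b k) ->
  derive1 F u = \sum_(0 <= k <oo) g' k.
Proof.
move=> u01 FE cg cg' cb rem; rewrite /derive1; apply: cvg_lim => //.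
set D := \sum_(0 <= k <oo) g' k.
have quad x : 0 < x < 1 -> `|F x - F u - (x - u) * D| <= (x - u) ^+ 2 * limn (series b).
  move=> x01.
  have -> : F x - F u - (x - u) * D =
      limn (series (fun k => g k x - g k u - (x - u) * g' k)).
    have cgB : cvgn (series (fun k => g k x - g k u)).
      by apply: cvg_seriesB; exact: cg.
    rewrite (lim_sub_series cgB (cvg_seriesZ cg')) lim_mulr_series //.
    by rewrite (lim_sub_series (cg _ x01) (cg _ u01)) !FE.
  rewrite -lim_mulr_series //.
  by apply: dominated_series_le => [k|]; [exact: rem | exact: cvg_seriesZ].
apply/cvgrPdist_le => e e0; near=> h.
have hu : 0 < h + u < 1.
  have : `|h| < Num.min u (1 - u).
    near: h; apply: dnbhs0_lt; rewrite lt_min subr_gt0; exact: u01.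
  by rewrite lt_min !ltr_norml; lra.
have h0 : h != 0 by near: h; exact: nbhs_dnbhs_neq.
have := quad _ hu; rewrite addrK => q.
rewrite distrC.
have -> : h^-1 *: (F (h + u) - F u) - D = h^-1 * (F (h + u) - F u - h * D).
  by rewrite [RHS]mulrBr mulKf.
rewrite normrM normfV ler_pdivrMl ?normr_gt0 //.
apply: le_trans q _; rewrite -(real_normK (num_real h)) expr2 -mulrA ler_wpM2l //.
(* Adding 1 keeps the denominator positive. *)
have : `|h| <= e / (`|limn (series b)| + 1).
  near: h; apply: dnbhs0_le; rewrite divr_gt0 // ltr_wpDl //.
rewrite ler_pdivlMr ?ltr_wpDl // => /(le_trans _) -> //.
by rewrite ler_wpM2l // (le_trans (ler_norm _)) // lerDl.
Unshelve. all: by end_near.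
Qed.

(** Expands one factor of a product at a time. The first two conclusions allow the series itself to
    serve as [h] in a further application. *)
Lemma Rintegral_mul_series01 (h : R -> R) (f : nat -> R -> R) (c b : nat -> R)
    (M N : R) :
  bounded_measurable01 h -> (forall x : R, 0 <= x <= 1 -> `|h x| <= M) ->
  (forall k, bounded_measurable01 (f k)) ->
  (forall k (x : R), 0 <= x <= 1 -> `|f k x| <= N) ->
  (forall k, `|c k| <= b k) -> cvgn (series b) ->
  [/\ bounded_measurable01 (fun x => \sum_(0 <= k <oo) (c k * f k x)),
      (forall x : R, 0 <= x <= 1 ->
        `|\sum_(0 <= k <oo) (c k * f k x)| <= N * limn (series b)) &
      \int[mu]_(x in `[0, 1]) (h x * \sum_(0 <= k <oo) (c k * f k x)) =
      \sum_(0 <= k <oo) (c k * \int[mu]_(x in `[0, 1]) (h x * f k x))].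
Proof.
move=> bh hM bf fN cb scb.
have dom k (x : R) : 0 <= x <= 1 -> `|c k * f k x| <= N * b k.
  by move=> x01; rewrite normrM mulrC ler_pM ?fN.
have bcf k : bounded_measurable01 (fun x => c k * f k x).
  by apply: bounded_measurable01M => //; exact: bounded_measurable01_cst.
have sNb : cvgn (series (fun k => N * b k)) by exact: cvg_seriesZ.
have [bS _] := Rintegral_series01 bcf dom sNb.
split=> //.
  move=> x x01; rewrite -lim_mulr_series //.
  by apply: dominated_series_le => // k; exact: dom.
have bhcf k : bounded_measurable01 (fun x => h x * (c k * f k x)).
  exact: bounded_measurable01M.
have dom2 k (x : R) : 0 <= x <= 1 -> `|h x * (c k * f k x)| <= M * (N * b k).
  by move=> x01; rewrite normrM ler_pM ?hM ?dom.
have [_ +] := Rintegral_series01 bhcf dom2 (cvg_seriesZ sNb).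
rewrite (_ : \sum_(0 <= k <oo) \int[mu]_(x in `[0, 1]) (h x * (c k * f k x)) = 
  \sum_(0 <= k <oo) (c k * \int[mu]_(x in `[0, 1]) (h x * f k x))); last first.
  apply: eq_sum_from => k _; rewrite -RintegralZl //.
    by apply: eq_Rintegral => x _; rewrite mulrCA.
  exact/bounded_measurable01_integrable/bounded_measurable01M.
move=> <-; apply: eq_Rintegral => x; rewrite inE /= in_itv /= => x01.
rewrite -[LHS]lim_mulr_series //.
by apply: dominated_cvg_series sNb => k; exact: dom.
Qed.

Lemma Rintegral01_le1 (f : R -> R) : bounded_measurable01 f ->
  (forall x : R, 0 <= x <= 1 -> `|f x| <= 1) ->
  `|\int[mu]_(x in `[0, 1]) f x| <= 1.
Proof.
move=> bf f1; have i := bounded_measurable01_integrable bf.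
apply: le_trans (le_normr_Rintegral _ i) _ => //.
rewrite -[leRHS]Rintegral_cst01; apply: le_Rintegral => //.
- exact: integrable_norm.
- exact/bounded_measurable01_integrable/bounded_measurable01_cst.
Qed.

(** In each term of the product the variables separate into [f k u * g j u] and [g k v * f j v]. The
    integral over [u] is expanded in [k], then in [j]; the integral over [v] is expanded in the same
    order. *)
Lemma Rintegral2_series01 (f g : nat -> R -> R) (w b : nat -> R) :
  (forall k, bounded_measurable01 (f k)) ->
  (forall k, bounded_measurable01 (g k)) ->
  (forall k (x : R), 0 <= x <= 1 -> `|f k x| <= 1) ->
  (forall k (x : R), 0 <= x <= 1 -> `|g k x| <= 1) ->
  (forall k, `|w k| <= b k) -> cvgn (series b) ->
  bounded_measurable01 (fun v => \int[mu]_(u in `[0, 1])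
    ((\sum_(0 <= k <oo) (w k * g k v * f k u)) *
     (\sum_(0 <= j <oo) (w j * f j v * g j u)))) /\
  \int[mu]_(v in `[0, 1]) \int[mu]_(u in `[0, 1])
    ((\sum_(0 <= k <oo) (w k * g k v * f k u)) *
     (\sum_(0 <= j <oo) (w j * f j v * g j u))) =
  \sum_(0 <= k <oo) \sum_(0 <= j <oo)
    (w k * w j * (\int[mu]_(x in `[0, 1]) (f k x * g j x)) *
                 (\int[mu]_(x in `[0, 1]) (f j x * g k x))).
Proof.
move=> bf bg f1 g1 wb cb.
pose J k j : R := \int[mu]_(x in `[0, 1]) (f k x * g j x).
have J1 k j : `|J k j| <= 1.
  apply: Rintegral01_le1; first exact: bounded_measurable01M.
  by move=> x x01; rewrite normrM mulr_ile1 ?f1 ?g1.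
have wle (t : nat -> R) k : `|t k| <= 1 -> `|w k * t k| <= b k.
  by move=> t1; rewrite normrM -[leRHS]mulr1 ler_pM.
(* After integration over [u], row [k] of the double series is [w k * g k v * S k v]. *)
pose S k (v : R) : R := \sum_(0 <= j <oo) (w j * J k j * f j v).
have wJ k j : `|w j * J k j| <= b j by exact: wle.
have inner (v : R) : 0 <= v <= 1 -> \int[mu]_(u in `[0, 1])
    ((\sum_(0 <= k <oo) (w k * g k v * f k u)) *
     (\sum_(0 <= j <oo) (w j * f j v * g j u))) =
    \sum_(0 <= k <oo) (w k * (g k v * S k v)).
  move=> v01.
  have wg k : `|w k * g k v| <= b k by apply: (wle (g ^~ v)); exact: g1.
  have wf k : `|w k * f k v| <= b k by apply: (wle (f ^~ v)); exact: f1.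
  have [bQ QM _] := Rintegral_mul_series01 (bounded_measurable01_cst 1)
    (fun x _ => lexx `|1|) bg g1 wf cb.
  have [_ _ E] := Rintegral_mul_series01 bQ QM bf f1 wg cb.
  under eq_Rintegral do rewrite mulrC; rewrite E.
  apply: eq_sum_from => k _; rewrite -mulrA; congr (_ * (_ * _)).
  have [_ _ E2] := Rintegral_mul_series01 (bf k) (f1 k) bg g1 wf cb.
  under eq_Rintegral do rewrite mulrC; rewrite E2.
  by apply: eq_sum_from => j _; rewrite mulrAC.
have bS k := Rintegral_mul_series01 (bg k) (g1 k) bf f1 (wJ k) cb.
have bgS k : bounded_measurable01 (fun v => g k v * S k v).
  by apply: bounded_measurable01M => //; have [] := bS k.
have gSM k (v : R) : 0 <= v <= 1 -> `|g k v * S k v| <= 1 * (1 * limn (series b)).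
  by move=> v01; rewrite normrM ler_pM ?g1 //; have [_ + _] := bS k; exact.
have [bgSs _ E1] := Rintegral_mul_series01 (bounded_measurable01_cst 1)
    (fun x _ => lexx `|1|) bgS gSM wb cb.
split; first exact: eq_bounded_measurable01 inner bgSs.
rewrite (_ : \int[mu]_(v in `[0, 1]) _ =
    \int[mu]_(v in `[0, 1]) (1 * \sum_(0 <= k <oo) (w k * (g k v * S k v)))); last first.
  by apply: eq_Rintegral => v; rewrite inE /= in_itv /= => v01; rewrite inner ?mul1r.
rewrite {}E1; apply: eq_sum_from => k _; under eq_Rintegral do rewrite mul1r.
have [_ _ ->] := bS k.
rewrite -[LHS]lim_mulr_series; last first.
  apply: dominated_cvg_series cb => j; rewrite -mulrA; apply: (wle (fun j => _)).
  rewrite normrM mulr_ile1 //; under eq_Rintegral do rewrite mulrC.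
  exact: J1.
apply: eq_sum_from => j _; under eq_Rintegral do rewrite mulrC.
by rewrite !mulrA.
Qed.

End TermwiseCalculus.

(** * Trigonometric integrals *)

Section Trigonometry.
Context {R : realType}.
Implicit Types (x y a b : R) (k j : nat).
Notation mu := (@lebesgue_measure R).

Lemma sin_natpi k : sin (k%:R * pi) = 0 :> R.
Proof.
elim: k => [|k IH]; first by rewrite mul0r sin0.
by rewrite -natr1 mulrDl mul1r sinDpi IH oppr0.
Qed.

Lemma cos_natpi k : cos (k%:R * pi) = (-1) ^+ k :> R.
Proof.
elim: k => [|k IH]; first by rewrite mul0r cos0.
by rewrite -natr1 mulrDl mul1r cosDpi IH exprS mulN1r.
Qed.

Lemma normr_sin_le1 x : `|sin x| <= 1.
Proof. by rewrite ler_norml sin_geN1 sin_le1. Qed.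

Lemma normr_cos_le1 x : `|cos x| <= 1.
Proof. by rewrite ler_norml cos_geN1 cos_le1. Qed.

(** The derivative is bounded only at points no farther from [a] than [b], so that [K] may depend on
    this distance, as in [sin_taylor1]. *)
Lemma MVT_le (f df : R -> R) a b (K : R) :
  (forall x, is_derive x 1 f (df x)) ->
  (forall x, `|x - a| <= `|b - a| -> `|df x| <= K) ->
  `|f b - f a| <= K * `|b - a|.
Proof.
move=> dF dfK; have cf : continuous f.
  move=> x; apply/differentiable_continuous/derivable1_diffP.
  exact: (@ex_derive _ _ _ _ _ _ _ (dF x)).
case: (ltgtP a b) => [ab|ba|->]; last by rewrite !subrr normr0 mulr0.
  have [c + ->] := MVT ab (fun x _ => dF x) (continuous_subspaceT cf).
  rewrite in_itv /= => /andP[ac cb]; rewrite normrM ler_wpM2r // dfK //.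
  by rewrite !ger0_norm; lra.
have [c + E] := MVT ba (fun x _ => dF x) (continuous_subspaceT cf).
rewrite in_itv /= => /andP[bc ca].
rewrite distrC E normrM (distrC a b) ler_wpM2r // dfK //.
by rewrite !ler0_norm; lra.
Qed.

Lemma sin_lipschitz a b : `|sin b - sin a| <= `|b - a|.
Proof.
rewrite -[leRHS]mul1r; apply: (@MVT_le _ cos) => x _; exact: normr_cos_le1.
Qed.

Lemma cos_lipschitz a b : `|cos b - cos a| <= `|b - a|.
Proof.
rewrite -[leRHS]mul1r; apply: (@MVT_le _ (fun x => - sin x)) => x _.
by rewrite normrN normr_sin_le1.
Qed.

(** The function [sin x - cos a * x] has derivative [cos x - cos a], which is at most [|b - a|]
    between [a] and [b]. The constant 1, instead of the optimal 1/2, suffices. *)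
Lemma sin_taylor1 a b : `|sin b - sin a - (b - a) * cos a| <= (b - a) ^+ 2.
Proof.
rewrite -(real_normK (num_real (b - a))) expr2.
have -> : sin b - sin a - (b - a) * cos a =
  (sin b - cos a * b) - (sin a - cos a * a) by ring.
apply: (@MVT_le (fun x => sin x - cos a * x) (fun x => cos x - cos a)) => x.
  by apply: is_derive_eq; rewrite /GRing.scale /= mulr1.
by move=> xab; rewrite (le_trans (cos_lipschitz _ _)).
Qed.

Lemma continuous_mulr_id a : continuous ( *%R a : R -> R).
Proof. by move=> x; apply: cvgM; [exact: cvg_cst | exact: cvg_id]. Qed.

Lemma continuous_sinM a : continuous (fun x : R => sin (a * x)).
Proof.
by move=> x; apply: continuous_comp; [exact: continuous_mulr_id | exact: continuous_sin].
Qed.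

Lemma continuous_cosM a : continuous (fun x : R => cos (a * x)).
Proof.
by move=> x; apply: continuous_comp; [exact: continuous_mulr_id | exact: continuous_cos].
Qed.

Lemma Rintegral_cos_sin a b : a ^+ 2 - b ^+ 2 != 0 ->
  \int[mu]_(x in `[0, 1]) (cos (a * x) * sin (b * x)) =
  (a * (sin a * sin b) + b * (cos a * cos b - 1)) / (a ^+ 2 - b ^+ 2).
Proof.
move=> ab; have cf : continuous (fun x : R => cos (a * x) * sin (b * x)).
  by move=> x; apply: cvgM; [exact: continuous_cosM | exact: continuous_sinM].
(* In the derivative of this combination the terms in [sin (a * x) * cos (b * x)] cancel. *)
have dF (x : R) : is_derive x 1 (fun x : R => (a ^+ 2 - b ^+ 2)^-1 *
   (a * (sin (a * x) * sin (b * x)) + b * (cos (a * x) * cos (b * x))))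
   (cos (a * x) * sin (b * x)).
  by apply: is_derive_eq; rewrite /GRing.scale /=; field.
rewrite (Rintegral01_FTC cf dF) !mulr1 !mulr0 sin0 cos0.
by field.
Qed.

Lemma Rintegral_cos_sin_diag a : a != 0 ->
  \int[mu]_(x in `[0, 1]) (cos (a * x) * sin (a * x)) = sin a ^+ 2 / (2 * a).
Proof.
move=> a0; have cf : continuous (fun x : R => cos (a * x) * sin (a * x)).
  by move=> x; apply: cvgM; [exact: continuous_cosM | exact: continuous_sinM].
have dF (x : R) : is_derive x 1 (fun x : R => (2 * a)^-1 * sin (a * x) ^+ 2)
    (cos (a * x) * sin (a * x)).
  by apply: is_derive_eq; rewrite /GRing.scale /=; field.
rewrite (Rintegral01_FTC cf dF) !mulr1 !mulr0 sin0.
by field.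
Qed.

Lemma Rintegral_cos_id a : a != 0 ->
  \int[mu]_(x in `[0, 1]) (cos (a * x) * x) = sin a / a + (cos a - 1) / a ^+ 2.
Proof.
move=> a0; have cf : continuous (fun x : R => cos (a * x) * x).
  by move=> x; apply: cvgM; [exact: continuous_cosM | exact: cvg_id].
have dF (x : R) : is_derive x 1 (fun x : R => x * sin (a * x) * a^-1 +
    cos (a * x) * a ^- 2) (cos (a * x) * x).
  by apply: is_derive_eq; rewrite /GRing.scale /=; field.
rewrite (Rintegral01_FTC cf dF) !mulr1 !mulr0 sin0 cos0.
by field.
Qed.

Lemma Rintegral_id01 : \int[mu]_(x in `[0 : R, 1]) x = 1 / 2.
Proof.
have dF (x : R) : is_derive x 1 (fun x : R => 2^-1 * x ^+ 2) x.
  by apply: is_derive_eq; rewrite /GRing.scale /=; field.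
rewrite (Rintegral01_FTC (fun x => cvg_id) dF); lra.
Qed.

Let pi0 : pi != 0 :> R. Proof. by rewrite gt_eqF // pi_gt0. Qed.

Lemma Rintegral_cos_sin_natpi k j : (0 < j)%N ->
  \int[mu]_(x in `[0, 1]) (cos (k%:R * pi * x) * sin (j%:R * pi * x)) =
  j%:R * ((-1) ^+ (k + j) - 1) / (pi * (k%:R ^+ 2 - j%:R ^+ 2)).
Proof.
move=> j0; have j0' : j%:R != 0 :> R by rewrite pnatr_eq0 -lt0n.
(* On the diagonal the integral vanishes because [sin (j pi) = 0], and the right-hand side because
   the inverse of 0 is 0. *)
have [->|kj] := eqVneq k j.
  rewrite Rintegral_cos_sin_diag ?mulf_neq0 // sin_natpi.
  by rewrite subrr mulr0 invr0 expr0n mul0r mulr0.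
have ab : k%:R ^+ 2 - j%:R ^+ 2 != 0 :> R.
  by rewrite subr_eq0 -!natrX eqr_nat eqn_exp2r.
have pq : (k%:R * pi) ^+ 2 - (j%:R * pi) ^+ 2 != 0 :> R.
  by rewrite !exprMn -mulrBl mulf_neq0 // expf_neq0.
rewrite Rintegral_cos_sin // !sin_natpi !cos_natpi -exprD.
move: (pi : R) pi0 pq => p p0 pq; field.
by rewrite p0 ab pq.
Qed.

Lemma Rintegral_cos_natpi_id k : (0 < k)%N ->
  \int[mu]_(x in `[0, 1]) (cos (k%:R * pi * x) * x) =
  ((-1) ^+ k - 1) / (k%:R * pi) ^+ 2.
Proof.
move=> k0; have k0' : k%:R != 0 :> R by rewrite pnatr_eq0 -lt0n.
by rewrite Rintegral_cos_id ?mulf_neq0 // sin_natpi cos_natpi mul0r add0r.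
Qed.

End Trigonometry.

(** * The copula as a sine series *)

Section Basis.
Context {R : realType}.
Notation mu := (@lebesgue_measure R).
Implicit Types (k j : nat) (x u v : R).

(* Index [0], which the series leaves free, carries the independence copula
   [u * v], so that [C] and its partial derivatives become plain series. *)
Definition cosine k x : R := cos (k%:R * pi * x).
Definition sine k x : R := if k is 0%N then x else sin (k%:R * pi * x).
(** Chosen so that [sine k] has derivative [freq k * cosine k]; for [k = 0] this is the constant 1,
    and [cosine 0] is already 1. *)
Definition freq k : R := if k is 0%N then 1 else k%:R * pi.

Lemma bounded_measurable01_cosine k : bounded_measurable01 (cosine k).
Proof. by apply: continuous_bounded_measurable01; exact: continuous_cosM. Qed.

Lemma bounded_measurable01_sine k : bounded_measurable01 (sine k).
Proof.
case: k => [|k]; first exact: bounded_measurable01_id.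
by apply: continuous_bounded_measurable01; exact: continuous_sinM.
Qed.

Lemma normr_cosine_le1 k x : `|cosine k x| <= 1.
Proof. exact: normr_cos_le1. Qed.

Lemma normr_sine_le1 k x : 0 <= x <= 1 -> `|sine k x| <= 1.
Proof.
case: k => [/andP[x0 x1]|k _] /=; first by rewrite ger0_norm.
exact: normr_sin_le1.
Qed.

Lemma sine_lipschitz k u x : `|sine k x - sine k u| <= freq k * `|x - u|.
Proof.
case: k => [|k] /=; first by rewrite mul1r.
rewrite (le_trans (sin_lipschitz _ _)) // -mulrBr normrM ger0_norm //.
by rewrite mulr_ge0 ?pi_ge0.
Qed.

Lemma sine_taylor1 k u x :
  `|sine k x - sine k u - (x - u) * (freq k * cosine k u)| <=
  freq k ^+ 2 * (x - u) ^+ 2.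
Proof.
case: k => [|k].
  by rewrite /cosine /= !mul0r cos0 !mulr1 subrr normr0 expr1n mul1r sqr_ge0.
rewrite /= -exprMn [_ * (x - u)]mulrBr.
rewrite (_ : _ * (_ * cosine _ _) = (k.+1%:R * pi * x - k.+1%:R * pi * u) * cosine k.+1 u).
  exact: sin_taylor1.
by rewrite -mulrBr mulrA [(x - u) * _]mulrC.
Qed.

Definition inner k j : R := \int[mu]_(x in `[0, 1]) (cosine k x * sine j x).

Let pi0 : pi != 0 :> R. Proof. by rewrite gt_eqF // pi_gt0. Qed.

Lemma inner00 : inner 0 0 = 1 / 2.
Proof.
rewrite -Rintegral_id01; apply: eq_Rintegral => x _.
by rewrite /cosine /= !mul0r cos0 mul1r.
Qed.

Lemma innerS k j : inner k j.+1 =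
  j.+1%:R * ((-1) ^+ (k + j.+1) - 1) / (pi * (k%:R ^+ 2 - j.+1%:R ^+ 2)).
Proof. exact: Rintegral_cos_sin_natpi. Qed.

Lemma innerS0 k : inner k.+1 0 = ((-1) ^+ k.+1 - 1) / (k.+1%:R * pi) ^+ 2.
Proof. exact: Rintegral_cos_natpi_id. Qed.

Lemma inner0S j : inner 0 j.+1 = (1 - (-1) ^+ j.+1) / (j.+1%:R * pi).
Proof.
rewrite innerS expr0n add0n sub0r.
have jn0 : j.+1%:R != 0 :> R by rewrite pnatr_eq0.
move: (j.+1%:R : R) ((-1) ^+ j.+1 : R) (pi : R) jn0 pi0 => a s p a0 p0; field.
by rewrite a0 p0.
Qed.

Lemma inner_diag k : inner k.+1 k.+1 = 0.
Proof. by rewrite innerS subrr mulr0 invr0 mulr0. Qed.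

Lemma integral_sine k : \int[mu]_(x in `[0, 1]) sine k x = inner 0 k.
Proof.
by apply: eq_Rintegral => x _; rewrite /cosine !mul0r cos0 mul1r.
Qed.

End Basis.

(** * Copula property of the sine series, and series for rho and tau *)

Section SineSeries.
Context {R : realType}.
Variable lam : nat -> R.
Hypothesis lam_le : forall n, \sum_(1 <= k < n) `|lam k| <= 1 / 2.
Notation mu := (@lebesgue_measure R).
Implicit Types (k j n : nat) (x u v c : R).

Definition coef k : R := if k is 0%N then 1 else 2 / pi ^+ 2 * (lam k / k%:R ^+ 2).

(* The constant [c] majorizes the term of index [0], where [lam] is not used. *)
Definition bound c k : R := if k is 0%N then c else `|lam k|.

Lemma bound_ge0 c k : 0 <= c -> 0 <= bound c k.
Proof. by case: k => /=. Qed.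

Lemma bound_cvg c : 0 <= c ->
  cvgn (series (bound c)) /\ limn (series (bound c)) <= c + 1 / 2.
Proof.
move=> c0; apply: nneg_series_cvg => [k|[|n]]; first exact: bound_ge0.
  by rewrite seriesEnat /= big_geq // addr_ge0 // divr_ge0.
rewrite seriesEnat /= big_ltn //= lerD2l (le_trans _ (lam_le n.+1)) //.
by rewrite le_eqVlt; apply/orP; left; apply/eqP; apply: eq_big_nat => -[].
Qed.

Let cvg1 := (bound_cvg (@ler01 R)).1.

Let pi_gt2 : 2 <= pi :> R. Proof. exact: pi_ge2. Qed.

Lemma coef_le k : `|coef k| <= bound 1 k.
Proof.
case: k => [|k] /=; first by rewrite normr1.
rewrite mulrCA normrM -[leRHS]mulr1 ler_wpM2l // ger0_norm; last first.
  by rewrite !mulr_ge0 ?invr_ge0 ?sqr_ge0 ?ler0n.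
rewrite -mulrA -invfM ler_pdivrMr ?mul1r; last first.
  by rewrite mulr_gt0 // exprn_gt0 // pi_gt0.
have k1 : 1 <= k.+1%:R ^+ 2 :> R by rewrite exprn_ege1 // ler1n.
have p2 : 2 <= pi ^+ 2 :> R by move: pi_gt2; move: (pi : R) => p; nra.
by rewrite -[leLHS]mulr1 ler_pM.
Qed.

(** For [k >= 1] the product is [2 * lam k / (pi * k)], and [pi >= 2]. *)
Lemma coef_freq_le k : `|coef k * freq k| <= bound 1 k.
Proof.
case: k => [|k] /=; first by rewrite mulr1 normr1.
have kn0 : k.+1%:R != 0 :> R by rewrite pnatr_eq0.
have -> : 2 / pi ^+ 2 * (lam k.+1 / k.+1%:R ^+ 2) * (k.+1%:R * pi) =
    lam k.+1 * (2 / (pi * k.+1%:R)).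
  have : pi != 0 :> R by rewrite gt_eqF // pi_gt0.
  move: (pi : R) (k.+1%:R : R) kn0 => p a a0 p0; field.
  by rewrite a0 p0.
rewrite normrM -[leRHS]mulr1 ler_wpM2l // ger0_norm; last first.
  by rewrite !(mulr_ge0, invr_ge0) ?pi_ge0 ?ler0n.
rewrite ler_pdivrMr ?mul1r; last by rewrite mulr_gt0 // pi_gt0.
by rewrite -[leLHS]mulr1 ler_pM // ler1n.
Qed.

(** The factor 2 matters: against a sum of [|lam k|] of at most 1/2 it gives 1, the weight of the
    term of index 0 in the volume of a rectangle. *)
Lemma coef_freq2 k : `|coef k.+1| * freq k.+1 ^+ 2 = 2 * `|lam k.+1|.
Proof.
have kn0 : k.+1%:R != 0 :> R by rewrite pnatr_eq0.
have p0 : pi != 0 :> R by rewrite gt_eqF // pi_gt0.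
rewrite /= mulrCA normrM [`|_ / _|]ger0_norm; last first.
  by rewrite !mulr_ge0 ?invr_ge0 ?sqr_ge0 ?ler0n.
rewrite normrM [`|_^-1|]ger0_norm ?invr_ge0 ?sqr_ge0 //.
move: (pi : R) (k.+1%:R : R) kn0 p0 => p a a0 p0; field.
by rewrite a0 p0.
Qed.

Lemma coef_freq2_le k : `|coef k| * freq k ^+ 2 <= 2 * bound 1 k.
Proof.
case: k => [|k]; last by rewrite coef_freq2.
by rewrite /= normr1 expr1n !mulr1 ler1n.
Qed.

Lemma sine_series_cvg x u : 0 <= x <= 1 -> 0 <= u <= 1 ->
  cvgn (series (fun k => coef k * sine k x * sine k u)).
Proof.
move=> x01 u01; apply: dominated_cvg_series cvg1 => k.
rewrite -mulrA normrM -[leRHS]mulr1 ler_pM ?coef_le //.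
by rewrite normrM mulr_ile1 ?normr_sine_le1.
Qed.

(** The Taylor remainder of [sine k] costs a factor [freq k ^+ 2], which the decay of [coef k]
    compensates exactly, leaving a multiple of [bound 1]. *)
Lemma derive1_sine_series (F : R -> R) c u : 0 <= c <= 1 -> 0 < u < 1 ->
  (forall x, 0 < x < 1 -> F x = \sum_(0 <= k <oo) (coef k * sine k c * sine k x)) ->
  derive1 F u = \sum_(0 <= k <oo) (coef k * freq k * sine k c * cosine k u).
Proof.
move=> c01 u01 FE.
apply: (derive1_series u01 FE (b := fun k => 2 * bound 1 k)).
- by move=> x /andP[x0 x1]; apply: sine_series_cvg => //; rewrite !ltW.
- apply: dominated_cvg_series cvg1 => k.
  rewrite -mulrA normrM -[leRHS]mulr1 ler_pM ?coef_freq_le //.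
  by rewrite normrM mulr_ile1 ?normr_sine_le1 ?normr_cosine_le1.
- exact: cvg_seriesZ.
- move=> k x.
  have -> : coef k * sine k c * sine k x - coef k * sine k c * sine k u -
      (x - u) * (coef k * freq k * sine k c * cosine k u) =
      sine k c * (coef k * (sine k x - sine k u - (x - u) * (freq k * cosine k u))).
    by ring.
  rewrite normrM -[leRHS]mul1r ler_pM ?normr_sine_le1 //.
  rewrite normrM (le_trans (ler_wpM2l _ (sine_taylor1 _ _ _))) //.
  rewrite [leRHS]mulrC (mulrA `|coef k|); apply: ler_wpM2r; [exact: sqr_ge0 | exact: coef_freq2_le].
Qed.

Variable C : R -> R -> R.
Hypothesis hC : forall u v : R, 0 <= u <= 1 -> 0 <= v <= 1 ->
  C u v = u * v + 2 / pi ^+ 2 *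
    \sum_(1 <= k <oo) (lam k / k%:R ^+ 2 * sin (k%:R * pi * u) * sin (k%:R * pi * v)).

Lemma copula_sine_series u v : 0 <= u <= 1 -> 0 <= v <= 1 ->
  C u v = \sum_(0 <= k <oo) (coef k * sine k u * sine k v).
Proof.
move=> u01 v01; rewrite hC // sum_recl; last exact: sine_series_cvg.
rewrite /= mul1r; congr (_ + _); rewrite !(sum_from_mkcond 1).
rewrite -[LHS]lim_mulr_series; last first.
  apply: dominated_cvg_series cvg1 => -[|k] /=; first by rewrite normr0.
  rewrite normrM -[leRHS]mulr1 ler_pM ?normr_sin_le1 //.
  rewrite normrM -[leRHS]mulr1 ler_pM ?normr_sin_le1 //.
  rewrite normrM -[leRHS]mulr1 ler_pM // normfV invf_le1 ?normrX ?exprn_ege1 //.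
    by rewrite normr_nat ler1n.
  by rewrite exprn_gt0 // normr_nat.
by apply: eq_sum_from => -[|k] _ /=; rewrite ?mulr0 // !mulrA.
Qed.

Lemma copula_2increasing_sine u1 u2 v1 v2 :
  0 <= u1 -> u1 <= u2 -> u2 <= 1 -> 0 <= v1 -> v1 <= v2 -> v2 <= 1 ->
  0 <= C u2 v2 - C u2 v1 - C u1 v2 + C u1 v1.
Proof.
move=> u10 u12 u21 v10 v12 v21.
have U1 : 0 <= u1 <= 1 by apply/andP; split; lra.
have U2 : 0 <= u2 <= 1 by apply/andP; split; lra.
have V1 : 0 <= v1 <= 1 by apply/andP; split; lra.
have V2 : 0 <= v2 <= 1 by apply/andP; split; lra.
pose D k := coef k * (sine k u2 - sine k u1) * (sine k v2 - sine k v1).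
have c22 := sine_series_cvg U2 V2; have c21 := sine_series_cvg U2 V1.
have c12 := sine_series_cvg U1 V2; have c11 := sine_series_cvg U1 V1.
have DE : (fun k => coef k * sine k u2 * sine k v2 - coef k * sine k u2 * sine k v1 -
    (coef k * sine k u1 * sine k v2 - coef k * sine k u1 * sine k v1)) = D.
  by apply/funext => k; rewrite /D; ring.
have cD : cvgn (series D) by rewrite -DE; apply: cvg_seriesB; exact: cvg_seriesB.
have -> : C u2 v2 - C u2 v1 - C u1 v2 + C u1 v1 = limn (series D).
  rewrite -DE lim_sub_series; [|exact: cvg_seriesB..].
  by rewrite !lim_sub_series // !copula_sine_series // opprB addrA addrAC.
have := sum_recl cD; rewrite -/(limn (series D)) => ->.
rewrite sum_from_mkcond {1}/D /= mul1r.
have [cb lb] := bound_cvg (lexx (0 : R)).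
set E := (u2 - u1) * (v2 - v1); have E0 : 0 <= E by rewrite mulr_ge0 // subr_ge0.
(* The term of index 0, the area [E], is left out here; hence [bound 0], whose sum is at most 1/2,
   so that the remaining terms amount to at most [E]. *)
have : `|\sum_(0 <= k <oo) (if (1 <= k)%N then D k else 0)| <= 2 * E * limn (series (bound 0)).
  rewrite -lim_mulr_series //.
  apply: dominated_series_le; last exact: cvg_seriesZ.
  move=> -[|k]; first by rewrite /= normr0 mulr0.
  rewrite ltn0Sn /D (normrM (coef k.+1 * _)) (normrM (coef k.+1)) [leRHS]mulrAC -coef_freq2.
  have -> : `|coef k.+1| * freq k.+1 ^+ 2 * E =
    `|coef k.+1| * (freq k.+1 * (u2 - u1)) * (freq k.+1 * (v2 - v1)) by rewrite /E; ring.
  have h (a b : R) : a <= b -> `|sine k.+1 b - sine k.+1 a| <= freq k.+1 * (b - a).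
    by move=> ab; rewrite (le_trans (sine_lipschitz _ _ _)) // ger0_norm ?subr_ge0.
  apply: ler_pM; [exact: mulr_ge0 | exact: normr_ge0 | | exact: h].
  by apply: ler_wpM2l => //; exact: h.
move=> /ler_normlP[+ _]; nra.
Qed.

Lemma is_copula_sine : is_copula C.
Proof.
have I0 : 0 <= (0 : R) <= 1 by rewrite lexx ler01.
have I1 : 0 <= (1 : R) <= 1 by rewrite lexx ler01.
split; last exact: copula_2increasing_sine.
- move=> v v01; rewrite hC // sum_eq0 ?mulr0 ?mul0r ?addr0 // => k _.
  by rewrite mulr0 sin0 mulr0 mul0r.
- move=> u u01; rewrite hC // sum_eq0 ?mulr0 ?mul0r ?addr0 // => k _.
  by rewrite mulr0 sin0 mulr0.
- move=> v v01; rewrite hC // sum_eq0 ?mulr0 ?mul1r ?addr0 // => k _.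
  by rewrite mulr1 sin_natpi mulr0 mul0r.
- move=> u u01; rewrite hC // sum_eq0 ?mulr0 ?mulr1 ?addr0 // => k _.
  by rewrite mulr1 sin_natpi mulr0.
Qed.

(** Integrating in [u] and then in [v] replaces each [sine k] by its integral [inner 0 k]. The term
    of index 0 contributes [12 * (1 / 4) = 3], which cancels the constant of the definition. *)
Lemma spearman_sine :
  spearman_rho C = 12 * \sum_(1 <= k <oo) (coef k * inner 0 k ^+ 2).
Proof.
rewrite /spearman_rho.
have dom k v : 0 <= v <= 1 -> `|coef k * sine k v| <= bound 1 k.
  by move=> v01; rewrite normrM -[leRHS]mulr1 ler_pM ?coef_le ?normr_sine_le1.
have bs := @bounded_measurable01_sine R; have s1 := @normr_sine_le1 R.
have in1 k : `|inner 0 k| <= 1 :> R.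
  by rewrite -integral_sine; apply: Rintegral01_le1 => // x; exact: s1.
have h1 := fun (x : R) (_ : 0 <= x <= 1) => lexx `|1 : R|.
rewrite (_ : \int[mu]_(v in _) _ = \int[mu]_(v in `[0, 1])
    (1 * \sum_(0 <= k <oo) (coef k * inner 0 k * sine k v))); last first.
  apply: eq_Rintegral => v; rewrite inE /= in_itv /= => v01.
  have [_ _ E] := Rintegral_mul_series01 (bounded_measurable01_cst 1) h1 bs s1
    (fun k => dom k v v01) cvg1.
  transitivity (\int[mu]_(u in `[0, 1])
      (1 * \sum_(0 <= k <oo) (coef k * sine k v * sine k u))).
    apply: eq_Rintegral => u; rewrite inE /= in_itv /= => u01.
    rewrite mul1r copula_sine_series //; apply: eq_sum_from => k _; exact: mulrAC.
  rewrite E mul1r; apply: eq_sum_from => k _.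
  by rewrite mulrAC -integral_sine; congr (_ * _ * _); apply: eq_Rintegral => x _; rewrite mul1r.
have domi k : `|coef k * inner 0 k| <= bound 1 k.
  by rewrite normrM -[leRHS]mulr1 ler_pM ?coef_le.
have [_ _ ->] := Rintegral_mul_series01 (bounded_measurable01_cst 1) h1 bs s1 domi cvg1.
rewrite (@eq_sum_from _ 0 _ (fun k => coef k * inner 0 k ^+ 2)); last first.
  move=> k _; rewrite expr2 mulrA; congr (_ * _); rewrite -integral_sine.
  by apply: eq_Rintegral => x _; rewrite mul1r.
rewrite sum_recl; last first.
  apply: dominated_cvg_series cvg1 => k; rewrite normrM -[leRHS]mulr1.
  by rewrite ler_pM ?coef_le // normrX exprn_ile1.
rewrite /= inner00; lra.
Qed.

Lemma kendall_sine : kendall_tau C = 1 - 4 *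
  \sum_(0 <= k <oo) \sum_(0 <= j <oo)
    (coef k * freq k * (coef j * freq j) * inner k j * inner j k).
Proof.
have bs := @bounded_measurable01_sine R; have s1 := @normr_sine_le1 R.
have bc := @bounded_measurable01_cosine R.
have c1 k (x : R) : 0 <= x <= 1 -> `|cosine k x| <= 1 by move=> _; exact: normr_cosine_le1.
have [bT <-] := Rintegral2_series01 bc bs c1 s1 coef_freq_le cvg1.
have oc x : 0 < x < 1 -> 0 <= x <= 1 by move=> /andP[? ?]; rewrite !ltW.
(* The partial derivatives are known to be series only for arguments in the open interval, so the
   integrand is replaced there, first in [v] and then in [u]. *)
congr (1 - 4 * _); apply: Rintegral_eq_oo bT _ => v v01.
have dom (t : nat -> R) k : `|t k| <= 1 -> `|coef k * freq k * t k| <= bound 1 k.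
  by move=> t1; rewrite normrM -[leRHS]mulr1 ler_pM ?coef_freq_le.
have h1 := fun (x : R) (_ : 0 <= x <= 1) => lexx `|1 : R|.
have [bP _ _] := Rintegral_mul_series01 (bounded_measurable01_cst 1) h1 bc c1
  (fun k => dom (sine ^~ v) k (s1 k v (oc v v01))) cvg1.
have [bQ _ _] := Rintegral_mul_series01 (bounded_measurable01_cst 1) h1 bs s1
  (fun k => dom (cosine ^~ v) k (c1 k v (oc v v01))) cvg1.
apply: Rintegral_eq_oo (bounded_measurable01M bP bQ) _ => u u01.
congr (_ * _).
  apply: derive1_sine_series (oc _ v01) u01 _ => x x01.
  rewrite copula_sine_series ?oc //; apply: eq_sum_from => k _; exact: mulrAC.
transitivity (\sum_(0 <= k <oo) (coef k * freq k * sine k u * cosine k v)).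
  apply: derive1_sine_series (oc _ u01) v01 _ => x x01.
  by rewrite copula_sine_series ?oc.
by apply: eq_sum_from => k _; exact: mulrAC.
Qed.

End SineSeries.

(** * Evaluation of the sums *)

Section SquareSums.
Context {R : realType}.
Implicit Types (T : nat -> nat -> R) (n : nat).

(** The partial sums on the left are the partial sums of even length on the right, a subsequence of
    a convergent sequence. *)
Lemma sum_odd (f : nat -> R) :
  cvgn (series (fun k => if odd k then f k else 0)) ->
  \sum_(0 <= k <oo) f (2 * k + 1)%N = \sum_(0 <= k <oo) (if odd k then f k else 0).
Proof.
move=> cf; apply: cvg_lim => //.
have -> : (fun n => \sum_(0 <= k < n) f (2 * k + 1)%N) =
    (fun n => series (fun k => if odd k then f k else 0) n.*2).
  apply/funext => n; rewrite seriesEnat /=; elim: n => [|n IH].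
    by rewrite !big_geq.
  by rewrite doubleS !big_nat_recr //= IH odd_double addr0 mul2n addn1.
have dbl : (fun n => n.*2) @ \oo --> \oo.
  apply/cvgnyPge => m; near=> i.
  have : (m <= i)%N by near: i; exists m.
  by lia.
exact: (cvg_comp _ _ dbl cf).
Unshelve. all: by end_near.
Qed.

(** Enlarging the square adds column [n]; row [n] has nothing above the diagonal. *)
Lemma triangle_sumS T n :
  \sum_(0 <= k < n.+1) \sum_(0 <= j < n.+1) (if (k < j)%N then T k j else 0) =
  \sum_(0 <= k < n) \sum_(0 <= j < n) (if (k < j)%N then T k j else 0) +
  \sum_(0 <= k < n) T k n.
Proof.
rewrite big_nat_recr //= [X in _ + X]big_nat [X in _ + X]big1 ?addr0; last first.
  by move=> j /andP[_]; rewrite ltnS leqNgt => /negbTE ->.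
rewrite -big_split /=; apply: eq_big_nat => k /andP[_ kn].
by rewrite big_nat_recr //= kn.
Qed.

Lemma square_sum_sym T n : (forall k j, T k j = T j k) ->
  \sum_(0 <= k < n) \sum_(0 <= j < n) T k j = \sum_(0 <= k < n) T k k +
  2 * \sum_(0 <= k < n) \sum_(0 <= j < n) (if (k < j)%N then T k j else 0).
Proof.
move=> Tsym; elim: n => [|n IH]; first by rewrite !big_geq // mulr0 addr0.
rewrite triangle_sumS big_nat_recr //=.
under eq_bigr do rewrite big_nat_recr //=.
rewrite big_split /= IH !big_nat_recr //=.
rewrite [X in _ + _ + (X + _)](eq_bigr (fun k => T k n)) //; ring.
Qed.

(** Expanding the product of the even and the odd sum yields [y k * y j] once for each pair [k < j]
    of opposite parity. In the induction, index [n] adds [y n] times the sum of the other parity. *)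
Lemma triangle_sum_le T (y : nat -> R) n :
  (forall k j, (k < j)%N -> `|T k j| <= if odd (k + j) then y k * y j else 0) ->
  `|\sum_(0 <= k < n) \sum_(0 <= j < n) (if (k < j)%N then T k j else 0)| <=
  (\sum_(0 <= k < n) (if odd k then 0 else y k)) *
  (\sum_(0 <= k < n) (if odd k then y k else 0)).
Proof.
move=> Ty; elim: n => [|n IH]; first by rewrite !big_geq // normr0 mul0r.
rewrite triangle_sumS !(big_nat_recr _ _ (fun k => if odd k then _ else _)) //=.
apply: le_trans (ler_normD _ _) _.
have : `|\sum_(0 <= k < n) T k n| <=
    \sum_(0 <= k < n) (if odd (k + n) then y k * y n else 0).
  apply: le_trans (ler_norm_sum _ _ _) _.
  by rewrite !big_nat; apply: ler_sum => k /andP[_ kn]; exact: Ty.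
have -> : \sum_(0 <= k < n) (if odd (k + n) then y k * y n else 0) =
    (if odd n then \sum_(0 <= k < n) (if odd k then 0 else y k)
     else \sum_(0 <= k < n) (if odd k then y k else 0)) * y n.
  rewrite (fun_if (fun z => z * y n)) !mulr_suml; case: ifP => on;
    by apply: eq_bigr => k _; rewrite oddD on; case: odd; rewrite ?mul0r.
by case: odd; nra.
Qed.

End SquareSums.

(** * Closed forms and estimates of the individual terms *)

Section Values.
Context {R : realType}.
Variable lam : nat -> R.
Implicit Types (k j n : nat).

Lemma pi_neq0 : pi != 0 :> R.
Proof. by rewrite gt_eqF // pi_gt0. Qed.

(** Indexed by all integers to be compared with [bound]; it vanishes at 0, so its sums from 0 and
    from 1 agree. *)
Definition odd_coef k : R := if odd k then lam k / k%:R ^+ 4 else 0.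

(** This is the [T(k, j)] of the double series for tau. *)
Definition pair_coef k j : R :=
  coef lam k * freq k * (coef lam j * freq j) * inner k j * inner j k.

Lemma pair_coef_sym k j : pair_coef k j = pair_coef j k.
Proof. by rewrite /pair_coef; ring. Qed.

Lemma pair_coef00 : pair_coef 0 0 = 1 / 4.
Proof. by rewrite /pair_coef /= inner00; field. Qed.

Lemma pair_coef_diag k : pair_coef k.+1 k.+1 = 0.
Proof. by rewrite /pair_coef inner_diag mulr0. Qed.

Lemma one_sub_signr k : 1 - (-1) ^+ k = (if odd k then 2 else 0) :> R.
Proof. by rewrite -signr_odd; case: odd; rewrite ?expr1 ?expr0; ring. Qed.

Lemma pair_coef0 j : pair_coef 0 j.+1 = - (8 / pi ^+ 4) * odd_coef j.+1.
Proof.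
have jn0 : j.+1%:R != 0 :> R by rewrite pnatr_eq0.
(* Parity is expressed by a polynomial in the sign, so that the identity becomes one of rational
   functions. *)
have -> : odd_coef j.+1 = (1 - (-1) ^+ j.+1) ^+ 2 / 4 * (lam j.+1 / j.+1%:R ^+ 4).
  by rewrite /odd_coef one_sub_signr; case: ifP => _; field.
rewrite /pair_coef inner0S innerS0 /=.
move: (j.+1%:R : R) ((-1) ^+ j.+1 : R) (pi : R) jn0 pi_neq0 => a s p a0 p0; field.
by rewrite a0 p0.
Qed.

Lemma coef_inner0 j : coef lam j.+1 * inner 0 j.+1 ^+ 2 = 8 / pi ^+ 4 * odd_coef j.+1.
Proof.
have jn0 : j.+1%:R != 0 :> R by rewrite pnatr_eq0.
have -> : odd_coef j.+1 = (1 - (-1) ^+ j.+1) ^+ 2 / 4 * (lam j.+1 / j.+1%:R ^+ 4).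
  by rewrite /odd_coef one_sub_signr; case: ifP => _; field.
rewrite inner0S /=.
move: (j.+1%:R : R) ((-1) ^+ j.+1 : R) (pi : R) jn0 pi_neq0 => a s p a0 p0; field.
by rewrite a0 p0.
Qed.

(** The two inner products have opposite denominators, whence the minus sign and the square. *)
Lemma pair_coefS k j : (0 < k)%N -> (k < j)%N ->
  pair_coef k j = - (2 / pi ^+ 4) *
   (2 * lam k * lam j / (k%:R ^+ 2 - j%:R ^+ 2) ^+ 2 *
    (1 - cos ((j + k)%:R * pi)) ^+ 2).
Proof.
case: k j => // k [//|j] _ kj.
have jn0 : j.+1%:R != 0 :> R by rewrite pnatr_eq0.
have kn0 : k.+1%:R != 0 :> R by rewrite pnatr_eq0.
have kj0 : k.+1%:R ^+ 2 - j.+1%:R ^+ 2 != 0 :> R.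
  by rewrite subr_eq0 -!natrX eqr_nat eqn_exp2r // ltn_eqF.
have jk0 : j.+1%:R ^+ 2 - k.+1%:R ^+ 2 != 0 :> R by rewrite -opprB oppr_eq0.
rewrite /pair_coef !innerS cos_natpi [(j.+1 + k.+1)%N]addnC /=.
move: (j.+1%:R : R) (k.+1%:R : R) ((-1) ^+ (k.+1 + j.+1) : R) (pi : R)
  jn0 kn0 kj0 jk0 pi_neq0 => a b s p a0 b0 ab ba p0; field.
by rewrite a0 b0 ab ba p0.
Qed.

Lemma odd_coef_le k : `|odd_coef k| <= bound lam 0 k.
Proof.
rewrite /odd_coef; case: k => [|k]; first by rewrite normr0.
case: ifP => _; last by rewrite normr0 /=.
rewrite normrM -[leRHS]mulr1 ler_pM //= normfV invf_le1 ?normrX ?normr_nat.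
  by rewrite exprn_ege1 // ler1n.
by rewrite exprn_gt0.
Qed.

(** After scaling by [pi ^+ 4 / 8], row 0 is [- odd_coef j] and, for [k + j] odd, the other rows are
    [- 2 * lam k * lam j] over a square of at least 9. The value 9/2 at index 0 brings both under
    the factor 2/9. *)
Lemma pair_coef_le k j : (k < j)%N ->
  `|pi ^+ 4 / 8 * pair_coef k j| <=
  if odd (k + j) then 2 / 9 * (bound lam (9 / 2) k * bound lam (9 / 2) j) else 0.
Proof.
case: k => [|k] kj.
  case: j kj => // j _; rewrite pair_coef0 add0n.
  have -> : pi ^+ 4 / 8 * (- (8 / pi ^+ 4) * odd_coef j.+1) = - odd_coef j.+1.
    by move: (pi : R) pi_neq0 => p p0; field.
  rewrite normrN; have := odd_coef_le j.+1; rewrite /odd_coef.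
  case: ifP => _; last by rewrite normr0.
  by move/le_trans; apply; rewrite /=; lra.
rewrite pair_coefS // cos_natpi one_sub_signr addnC.
set d := _ ^+ 2 - _ ^+ 2.
case: ifP => okj; last by rewrite expr0n !mulr0 normr0.
(* Squares of distinct positive integers differ by at least 3, as for 1 and 2. *)
have d9 : 9 <= d ^+ 2.
  have : (k.+1 ^ 2 + 3 <= j ^ 2)%N.
    by rewrite (@leq_trans (k.+2 ^ 2)) ?leq_sqr // -!mulnn; lia.
  rewrite -(ler_nat R) natrD !natrX /d => h; nra.
have -> : pi ^+ 4 / 8 * (- (2 / pi ^+ 4) * (2 * lam k.+1 * lam j / d ^+ 2 * 2 ^+ 2)) =
    - 2 * (lam k.+1 * lam j) / d ^+ 2.
  have d0 : d != 0 by apply: contraTneq d9 => ->; rewrite expr0n /= -ltNge; lra.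
  by move: (pi : R) pi_neq0 => p p0; field; rewrite p0 d0.
rewrite normrM normfV [`|d ^+ 2|]ger0_norm ?sqr_ge0 // ler_pdivrMr; last by lra.
rewrite !normrM normrN normr_nat.
have -> : bound lam (9 / 2) j = `|lam j| by case: j kj {okj d d9}.
rewrite /=; have : 0 <= `|lam k.+1| * `|lam j| by rewrite mulr_ge0.
nra.
Qed.

End Values.

(** * Summation of the double series and the sharp estimate for tau *)

Section Concordance.
Context {R : realType}.
Variable lam : nat -> R.
Hypothesis lam_le : forall n, \sum_(1 <= k < n) `|lam k| <= 1 / 2.
Implicit Types (k j n : nat).

Let b1 := bound lam 1.
Let cvg1 : cvgn (series b1) := (bound_cvg lam_le (@ler01 R)).1.
Let b10 k : 0 <= b1 k := bound_ge0 lam k (@ler01 R).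

Lemma odd_coef_cvg : cvgn (series (odd_coef lam)).
Proof.
exact: dominated_cvg_series (odd_coef_le lam) (bound_cvg lam_le (lexx 0)).1.
Qed.

Lemma odd_coef_sum_le : `|\sum_(0 <= k <oo) odd_coef lam k| <= 1 / 2.
Proof.
have [cb lb] := bound_cvg lam_le (lexx 0).
apply: le_trans (dominated_series_le (odd_coef_le lam) cb) _.
by rewrite (le_trans lb) // add0r.
Qed.

(** A crude estimate that serves only the convergence of the double series; the constant in the
    bound on tau comes from [pair_coef_le]. *)
Lemma pair_coef_bound k j : `|pair_coef lam k j| <= b1 k * b1 j.
Proof.
have in1 i l : `|inner i l| <= 1 :> R.
  apply: Rintegral01_le1.
    apply: bounded_measurable01M; first exact: bounded_measurable01_cosine.
    exact: bounded_measurable01_sine.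
  by move=> x x01; rewrite normrM mulr_ile1 ?normr_cosine_le1 ?normr_sine_le1.
rewrite /pair_coef -mulrA normrM -[leRHS]mulr1 ler_pM //.
  by rewrite normrM ler_pM ?coef_freq_le.
by rewrite normrM mulr_ile1.
Qed.

Definition upper_pair k j : R := if (k < j)%N then pair_coef lam k j else 0.

Lemma upper_pair_bound k j : `|upper_pair k j| <= b1 k * b1 j.
Proof.
rewrite /upper_pair; case: ifP => _; first exact: pair_coef_bound.
by rewrite normr0 mulr_ge0.
Qed.

Lemma upper_pair_cvg k : cvgn (series (upper_pair k)).
Proof. exact: dominated_cvg_series (upper_pair_bound k) (cvg_seriesZ cvg1). Qed.

Lemma upper_row_cvg : cvgn (series (fun k => \sum_(0 <= j <oo) upper_pair k j)).
Proof.
apply: (@dominated_cvg_series _ _ (fun k => limn (series b1) * b1 k)); last exact: cvg_seriesZ.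
move=> k; rewrite mulrC -lim_mulr_series //.
exact: dominated_series_le (upper_pair_bound k) (cvg_seriesZ cvg1).
Qed.

Lemma pair_coef_sum : \sum_(0 <= k <oo) \sum_(0 <= j <oo) pair_coef lam k j =
  1 / 4 + 2 * \sum_(0 <= k <oo) \sum_(0 <= j <oo) upper_pair k j.
Proof.
have cP := cvg_square_sums pair_coef_bound cvg1.
have cU := cvg_square_sums upper_pair_bound cvg1.
rewrite -(cvg_lim (@Rhausdorff R) cP); apply: cvg_lim => //.
(* Squares of side [n.+1] contain the entry (0, 0), the only nonzero one on the diagonal. *)
rewrite -cvg_shiftS; rewrite -cvg_shiftS in cU.
rewrite (_ : (fun n => _) = (fun n => 1 / 4 +
  2 * \sum_(0 <= k < n.+1) \sum_(0 <= j < n.+1) upper_pair k j)).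
  by apply: cvgD; [exact: cvg_cst | apply: cvgM => //; exact: cvg_cst].
apply/funext => n; rewrite square_sum_sym; last exact: pair_coef_sym.
congr (_ + _); rewrite big_nat_recl //= pair_coef00 big1 ?addr0 // => k _.
exact: pair_coef_diag.
Qed.

Lemma upper_pair_square_le n :
  `|\sum_(0 <= k < n) \sum_(0 <= j < n) upper_pair k j| <= 4 / pi ^+ 4.
Proof.
have p4 : 0 < pi ^+ 4 / 8 :> R by rewrite divr_gt0 // exprn_gt0 // pi_gt0.
rewrite -(ler_pM2l p4) -{1}(ger0_norm (ltW p4)) -normrM.
rewrite (_ : _ / 8 * (4 / _) = 1 / 2); last first.
  by move: (pi : R) (@pi_neq0 R) => p p0; field.
(* With y_0 = 9/2 the row k = 0 obeys the same bound as the others, where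
   (k^2 - j^2)^2 >= 9; the product of the even and the odd part is then at most
   9/2 * 1/2. *)
pose y k := bound lam (9 / 2) k.
have ysum : \sum_(0 <= k < n) y k <= if n is 0%N then 0 else 5.
  case: n => [|n]; first by rewrite big_geq.
  rewrite big_ltn //=; have := lam_le n.+1.
  rewrite (@eq_big_nat _ _ _ 1 n.+1 y (fun k => `|lam k|)); last by case.
  lra.
have n92 : `|9 / 2| = 9 / 2 :> R by rewrite ger0_norm //; lra.
have y0 k : 0 <= y k by apply: bound_ge0; lra.
(* The factor 9/2 cancels the 2/9 of [pair_coef_le]. *)
pose T k j : R := 9 / 2 * (pi ^+ 4 / 8 * pair_coef lam k j).
have TU : \sum_(0 <= k < n) \sum_(0 <= j < n) (if (k < j)%N then T k j else 0) =
    9 / 2 * (pi ^+ 4 / 8 * \sum_(0 <= k < n) \sum_(0 <= j < n) upper_pair k j).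
  rewrite !mulr_sumr; apply: eq_bigr => k _; rewrite !mulr_sumr.
  by apply: eq_bigr => j _; rewrite /upper_pair; case: ifP; rewrite ?mulr0.
have Ty k j : (k < j)%N -> `|T k j| <= if odd (k + j) then y k * y j else 0.
  move=> kj; have := pair_coef_le lam kj.
  rewrite /T (normrM (9 / 2)) n92.
  by case: ifP => _; rewrite -/(y k) -/(y j); lra.
have := triangle_sum_le n Ty; rewrite TU (normrM (9 / 2)) n92.
set E := \sum_(0 <= k < n) (if odd k then 0 else y k).
set O := \sum_(0 <= k < n) (if odd k then y k else 0).
have EO : E + O = \sum_(0 <= k < n) y k.
  by rewrite -big_split /=; apply: eq_bigr => k _; case: odd; rewrite ?addr0 ?add0r.
have O0 : 0 <= O by apply: sumr_ge0 => k _; case: odd.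
have Ey : (if n is 0%N then 0 else 9 / 2) <= E.
  rewrite /E; case: (n) => [|m]; first by rewrite big_geq.
  rewrite big_ltn //= lerDl; apply: sumr_ge0 => k _; by case: odd.
(* For a nonempty square, [E >= 9/2] and [E + O <= 5] force [O <= 1/2]. As [(5 - O) * O] increases
   there, [E * O <= 9/4], which is 9/2 times the claimed 1/2. *)
move: ysum Ey; rewrite -EO; case: (n) => [|m]; nra.
Qed.

Lemma upper_pair_sum_le :
  `|\sum_(0 <= k <oo) \sum_(0 <= j <oo) upper_pair k j| <= 4 / pi ^+ 4.
Proof.
have /(_ _) cU := cvg_norm (cvg_square_sums upper_pair_bound cvg1).
rewrite -(cvg_lim (@Rhausdorff R) cU); apply: limr_le.
  by apply/cvg_ex; eexists; exact: cU.
by apply: nearW => n; exact: upper_pair_square_le.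
Qed.

Lemma upper_pair_sumE : - 8 * \sum_(0 <= k <oo) \sum_(0 <= j <oo) upper_pair k j =
  64 / pi ^+ 4 * \sum_(0 <= k <oo) odd_coef lam k +
  16 / pi ^+ 4 * \sum_(1 <= k <oo) \sum_(k.+1 <= j <oo)
    (2 * lam k * lam j / (k%:R ^+ 2 - j%:R ^+ 2) ^+ 2
     * (1 - cos ((j + k)%:R * pi)) ^+ 2).
Proof.
have row0 : \sum_(0 <= j <oo) upper_pair 0 j =
    - (8 / pi ^+ 4) * \sum_(0 <= k <oo) odd_coef lam k.
  rewrite -[RHS]lim_mulr_series; last exact: odd_coef_cvg.
  apply: eq_sum_from => -[|j] _; first by rewrite /odd_coef mulr0.
  exact: pair_coef0.
(* Inverse of the factor [- (2 / pi ^+ 4)] of [pair_coefS]; multiplied by -8, that factor gives the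
   16 of the formula, just as row 0 gives [8 * 8 = 64]. *)
pose c : R := - (pi ^+ 4 / 2).
have rows : \sum_(1 <= k <oo) \sum_(k.+1 <= j <oo)
    (2 * lam k * lam j / (k%:R ^+ 2 - j%:R ^+ 2) ^+ 2
     * (1 - cos ((j + k)%:R * pi)) ^+ 2) =
   c * \sum_(1 <= k <oo) \sum_(0 <= j <oo) upper_pair k j.
  rewrite -(sum1_mulr c upper_row_cvg); apply: eq_sum_from => k k1.
  rewrite -[RHS]lim_mulr_series ?sum_from_mkcond; last exact: upper_pair_cvg.
  apply: eq_sum_from => j _; rewrite /upper_pair; case: ifP => [kj|_]; last by rewrite mulr0.
  rewrite pair_coefS // [RHS]mulrA (_ : c * _ = 1) ?mul1r // /c.
  by move: (pi : R) (@pi_neq0 R) => p p0; field.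
rewrite (sum_recl upper_row_cvg) row0 rows.
by rewrite /c; move: (pi : R) (@pi_neq0 R) => p p0; field.
Qed.

End Concordance.

Theorem lemma3 (R : realType) (lam : nat -> R) (C : R -> R -> R)
  (hlam : (\sum_(1 <= k <oo) `|lam k|%:E <= (1 / 2)%:E)%E)
  (hC : forall u v : R, 0 <= u <= 1 -> 0 <= v <= 1 ->
     C u v = u * v + 2 / pi ^+ 2 *
       \sum_(1 <= k <oo)
         (lam k / k%:R ^+ 2 * sin (k%:R * pi * u) * sin (k%:R * pi * v))) :
  [/\ is_copula C,
      kendall_tau C =
        64 / pi ^+ 4 *
          \sum_(0 <= k <oo) (lam (2 * k + 1)%N / (2 * k + 1)%:R ^+ 4)
        + 16 / pi ^+ 4 *
          \sum_(1 <= k <oo) \sum_(k.+1 <= j <oo)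
            (2 * lam k * lam j / (k%:R ^+ 2 - j%:R ^+ 2) ^+ 2
             * (1 - cos ((j + k)%:R * pi)) ^+ 2),
      spearman_rho C =
        96 / pi ^+ 4 *
          \sum_(0 <= k <oo) (lam (2 * k + 1)%N / (2 * k + 1)%:R ^+ 4),
      - (48 / pi ^+ 4) <= spearman_rho C <= 48 / pi ^+ 4 &
      - (32 / pi ^+ 4) <= kendall_tau C <= 32 / pi ^+ 4].
Proof.
(* The extended real sum is infinite for a divergent series, so the hypothesis bounds every partial
   sum. *)
have lam_le n : \sum_(1 <= k < n) `|lam k| <= 1 / 2.
  rewrite -lee_fin -sumEFin; apply: le_trans hlam.
  exact: nneseries_lim_ge.
have cop := is_copula_sine lam_le hC.
have rho := spearman_sine lam_le hC.
have tau := kendall_sine lam_le hC.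
rewrite (sum_odd (f := fun k => lam k / k%:R ^+ 4)); last exact: odd_coef_cvg lam_le.
have odd_le := odd_coef_sum_le lam_le.
have p4 : 0 < (pi ^+ 4)^-1 :> R by rewrite invr_gt0 exprn_gt0 // pi_gt0.
(* The diagonal term 1/4 cancels the leading 1, since [1 - 4 * (1/4 + 2 * s) = - 8 * s]. *)
have tauE : kendall_tau C =
    - 8 * \sum_(0 <= k <oo) \sum_(0 <= j <oo) upper_pair lam k j.
  by rewrite tau (pair_coef_sum lam_le); field.
have rhoE : spearman_rho C = 96 / pi ^+ 4 * \sum_(0 <= k <oo) odd_coef lam k.
  have -> : \sum_(0 <= k <oo) odd_coef lam k = \sum_(1 <= k <oo) odd_coef lam k.
    by rewrite (sum_recl (odd_coef_cvg lam_le)) add0r.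
  rewrite rho (_ : 96 / pi ^+ 4 = 12 * (8 / pi ^+ 4)); last by rewrite mulrA -natrM.
  rewrite -[RHS]mulrA -(sum1_mulr _ (odd_coef_cvg lam_le)); congr (_ * _).
  by apply: eq_sum_from => -[//|k] _; exact: coef_inner0.
split=> //.
- by rewrite tauE (upper_pair_sumE lam_le).
- rewrite -ler_norml rhoE -!mulrA normrM normr_nat.
  rewrite (_ : 48 / pi ^+ 4 = 96 * ((pi ^+ 4)^-1 * (1 / 2))); last first.
    by move: (pi : R) (@pi_neq0 R) => p ?; field.
  by rewrite ler_pM2l // normrM gtr0_norm // ler_pM2l.
- rewrite -ler_norml tauE normrM normrN normr_nat.
  rewrite (_ : 32 / pi ^+ 4 = 8 * (4 / pi ^+ 4)); last by rewrite mulrA -natrM.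
  by rewrite ler_pM2l //; exact: upper_pair_sum_le.
Qed.
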